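(* Let $0<x_1<\infty$, let $a,f\in S[0,x_1]$, suppose $x_1<\sqrt{2/|a|_0}$, and let $\alpha,\beta$ be given real numbers. Let $I_1,I_2,F$ be the functions on $[0,x_1]$ built from $a$ and $f$ as in the context. If $I_2(x_1)\neq0$, then the boundary value problem of finding $u\in W^2_\infty[0,x_1]\cap C^1[0,x_1]$ with $$\frac{d^2u}{dx^2}+a(x)u=f(x)\ \text{ on }[0,x_1],\qquad u(0)=\alpha,\qquad u'(x_1)=\beta$$ has a solution, which is given by the formula $$u(x)=\beta I_1(x)+\alpha I_2(x)+F(x).$$
   Context: All functions are real-valued. $S[0,x_1]$ is the class of measurable, essentially bounded functions on $[0,x_1]$, with norm $|h|_0=\operatorname{ess\,sup}_{x\in[0,x_1]}|h(x)|$. $W^2_\infty[0,x_1]$ is the class of functions $h$ on $[0,x_1]$ whose second (weak) derivative $\frac{d^2h}{dx^2}$ belongs to $S[0,x_1]$. Since $a,f$ are only essentially bounded, the equation is understood to hold for almost every $x\in[0,x_1]$. The condition $x_1<\sqrt{2/|a|_0}$ means $|a|_0x_1^2<2$ (no restriction if $|a|_0=0$). Define, for continuous $u$ on $[0,x_1]$, $$(Bu)(x)=\int_0^x\int_y^{x_1}a(t)u(t)\,dt\,dy,\qquad (B^0u)(x)=u(x),\qquad (B^ku)(x)=(B(B^{k-1}u))(x)\ (k\ge1),$$ $$g(x)=-\int_0^x\int_y^{x_1}f(t)\,dt\,dy,$$ $$a_1(x)=\int_0^x\int_y^{x_1}t\,a(t)\,dt\,dy,\qquad b_1(x)=\int_0^x\int_y^{x_1}a(t)\,dt\,dy,$$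 $$a_k(x)=\int_0^x\int_y^{x_1}a(t)a_{k-1}(t)\,dt\,dy,\qquad b_k(x)=\int_0^x\int_y^{x_1}a(t)b_{k-1}(t)\,dt\,dy\quad(k=2,3,\dots),$$ and $$I_1(x)=x+\sum_{k=1}^\infty a_k(x),\qquad I_2(x)=1+\sum_{k=1}^\infty b_k(x),\qquad F(x)=\sum_{k=0}^\infty(B^kg)(x).$$ Under the condition $x_1<\sqrt{2/|a|_0}$ these series converge uniformly on $[0,x_1]$. *)

(* Defs.v *)
From HB Require Import structures.
From mathcomp Require Import all_boot all_order all_algebra.
From mathcomp Require Import all_classical all_reals all_analysis.
From mathcomp Require Import ess_sup_inf.

Set Implicit Arguments.
Unset Strict Implicit.
Unset Printing Implicit Defensive.
Import Order.TTheory GRing.Theory Num.Theory.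
Import numFieldNormedType.Exports.

Local Open Scope classical_set_scope.
Local Open Scope ring_scope.

(* Functions on [0, x1] are functions R -> R whose values
   outside [0, x1] play no role. "Measurable" and integrals are relative to the
   completed Lebesgue measure, i.e. to the sigma-algebra of all
   Lebesgue-measurable sets and not only the Borel sets. *)
Notation leb R := (@completed_lebesgue_measure R).

Section function_spaces.
Context {R : realType}.
Implicit Types (x l : R) (h w u phi : R -> R) (D K : set R).

(* The extension by 0 outside [0, x1] does not affect the essential supremum
   since |h| >= 0 and x1 > 0. *)
Definition S_norm x1 h : \bar R :=
  ess_sup (leb R) (patch (fun=> 0%E) `[0, x1] (fun x => `|h x|%:E)).

Definition S_space x1 h : Prop :=
  @measurable_fun _ _ (caratheodory_type (@wlength R idfun)^*%mu) R
    `[0, x1] h /\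
  (S_norm x1 h < +oo)%E.

Definition loc_integrable D h : Prop :=
  forall K, K `<=` D -> compact K -> (leb R).-integrable K (EFin \o h).

(* phi is in C_c^oo(]0, x1[). *)
Definition test_function x1 phi : Prop :=
  let supp := closure [set x | phi x != 0] in
  [/\ forall n x, derivable (derive1n n phi) x 1,
      compact supp &
      supp `<=` `]0, x1[].

Definition is_weak_derive2 x1 h w : Prop :=
  [/\ loc_integrable `]0, x1[ h,
      loc_integrable `]0, x1[ w &
      forall phi, test_function x1 phi ->
        \int[leb R]_(x in `[0, x1]) (h x * derive1n 2 phi x) =
        \int[leb R]_(x in `[0, x1]) (w x * phi x)].

Definition W2oo x1 h : Prop :=
  exists2 w, is_weak_derive2 x1 h w & S_space x1 w.

(* Derivative at x relative to [0, x1], hence one-sided at the end points. *)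
Definition is_derive_on x1 u x l : Prop :=
  (u y - u x) / (y - x) @[y --> within `[0, x1] x^'] --> l.

Definition C1 x1 u : Prop :=
  exists2 u' : R -> R, {within `[0, x1], continuous u'} &
    forall x, x \in `[0, x1] -> is_derive_on x1 u x (u' x).

End function_spaces.

Section boundary_value_problem.
Context {R : realType}.
Implicit Types (a f u : R -> R) (alpha beta x y t : R) (k : nat).

Definition bvp_solution a f x1 alpha beta u : Prop :=
  [/\ W2oo x1 u,
      C1 x1 u,
      (exists2 w, is_weak_derive2 x1 u w &
        \forall x \ae leb R, x \in `[0, x1] -> w x + a x * u x = f x),
      u 0 = alpha &
      is_derive_on x1 u x1 beta].

Definition B_op a x1 u : R -> R := fun x =>
  \int[leb R]_(y in `[0, x]) \int[leb R]_(t in `[y, x1]) (a t * u t).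

Definition g_fun f x1 : R -> R := fun x =>
  - \int[leb R]_(y in `[0, x]) \int[leb R]_(t in `[y, x1]) f t.

(* The sequences a_k and b_k start at k = 1; the values at k = 0 are unused. *)
Fixpoint a_seq a x1 k : R -> R :=
  match k with
  | 0%N => fun=> 0
  | 1%N => fun x =>
      \int[leb R]_(y in `[0, x]) \int[leb R]_(t in `[y, x1]) (t * a t)
  | k'.+1 => fun x =>
      \int[leb R]_(y in `[0, x]) \int[leb R]_(t in `[y, x1])
        (a t * a_seq a x1 k' t)
  end.

Fixpoint b_seq a x1 k : R -> R :=
  match k with
  | 0%N => fun=> 0
  | 1%N => fun x =>
      \int[leb R]_(y in `[0, x]) \int[leb R]_(t in `[y, x1]) a t
  | k'.+1 => fun x =>
      \int[leb R]_(y in `[0, x]) \int[leb R]_(t in `[y, x1])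
        (a t * b_seq a x1 k' t)
  end.

Definition I1 a x1 : R -> R := fun x =>
  x + limn (fun n => \sum_(1 <= k < n) a_seq a x1 k x).

Definition I2 a x1 : R -> R := fun x =>
  1 + limn (fun n => \sum_(1 <= k < n) b_seq a x1 k x).

Definition F_fun a f x1 : R -> R := fun x =>
  limn (fun n => \sum_(0 <= k < n) iter k (B_op a x1) (g_fun f x1) x).

End boundary_value_problem.

(* Main.v *)
(** With [B] for [B_op a x1], a function [u] on [[0, x1]] solving
    [u = alpha + beta x + g + B u] also has the form
    [u = alpha + beta x - int_0^x int_y^x1 w] with [w = f - a u], so it solves
    the boundary value problem with [u'' = w]. As [int_0^x (x1 - y) dy] is at
    most [x1^2 / 2], the operator [B] contracts the sup norm by the factor
    [|a|_0 x1^2 / 2 < 1], and its Neumann series applied to [x], [1] and [g] are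
    [I1], [I2] and [F]; the integral equation then follows by linearity. That
    [w] is the weak second derivative is integration by parts, applied twice. *)
Require Import Defs.
From mathcomp Require Import all_boot all_order all_algebra.
From mathcomp Require Import all_classical all_reals all_analysis.
From mathcomp Require Import measurable_realfun ess_sup_inf ring lra.
Set Implicit Arguments.
Unset Strict Implicit.
Unset Printing Implicit Defensive.
Import Order.TTheory GRing.Theory Num.Theory.
Import numFieldNormedType.Exports.

Local Open Scope classical_set_scope.
Local Open Scope ring_scope.

(** * Essentially bounded functions *)

Section ess_bounded.
Context d (T : measurableType d) (R : realType).
Variable mu : {measure set T -> \bar R}.
Implicit Types (h k : T -> R) (M N : R) (D : set T).

(** The bound [M] is explicit and need not be the least one, so that bounds for sums, products and
    integrals are computed along with the functions; [0 <= M] is recorded because an estimate on a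
    null set would not give it. *)
Definition ess_bounded D M h : Prop :=
  [/\ 0 <= M, measurable_fun D h & \forall x \ae mu, D x -> `|h x| <= M].

Lemma ess_bounded_ge0 D M h : ess_bounded D M h -> 0 <= M.
Proof. by case. Qed.

Lemma bounded_ess_bounded D M h : 0 <= M ->
  measurable_fun D h -> (forall x, D x -> `|h x| <= M) -> ess_bounded D M h.
Proof. by move=> M0 mh hM; split => //; exact: aeW. Qed.

Lemma ess_bounded_cst D M : ess_bounded D `|M| (fun=> M).
Proof. exact: bounded_ess_bounded. Qed.

Lemma ess_boundedS D D' M h : measurable D -> D' `<=` D ->
  ess_bounded D M h -> ess_bounded D' M h.
Proof.
move=> mD D'D [M0 mh hM]; split => //; first exact: measurable_funS mh.
by apply: filterS hM => x + /D'D.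
Qed.

Lemma ess_boundedD D M N h k : ess_bounded D M h -> ess_bounded D N k ->
  ess_bounded D (M + N) (fun t => h t + k t).
Proof.
move=> [M0 mh hM] [N0 mk kN]; split; first exact: addr_ge0.
- exact: measurable_funD.
- apply: filterS2 hM kN => x hx kx Dx.
  by rewrite (le_trans (ler_normD _ _))// lerD// ?hx ?kx.
Qed.

Lemma ess_boundedM D M N h k : ess_bounded D M h -> ess_bounded D N k ->
  ess_bounded D (M * N) (fun t => h t * k t).
Proof.
move=> [M0 mh hM] [N0 mk kN]; split; first exact: mulr_ge0.
- exact: measurable_funM.
- apply: filterS2 hM kN => x hx kx Dx.
  by rewrite normrM ler_pM// ?hx ?kx.
Qed.

Lemma ess_boundedN D M h : ess_bounded D M h ->
  ess_bounded D M (fun t => - h t).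
Proof.
move=> [M0 mh hM]; split=> //; first exact: measurableT_comp.
by apply: filterS hM => x; rewrite normrN.
Qed.

Lemma ess_boundedB D M N h k : ess_bounded D M h -> ess_bounded D N k ->
  ess_bounded D (M + N) (fun t => h t - k t).
Proof. by move=> hM /ess_boundedN; exact: ess_boundedD. Qed.

Lemma ess_bounded_le_integral D M h : measurable D -> ess_bounded D M h ->
  (\int[mu]_(x in D) `|(h x)%:E| <= M%:E * mu D)%E.
Proof.
move=> mD [M0 mh hM]; rewrite -integral_cst//.
apply: ae_ge0_le_integral => //.
by apply: measurableT_comp => //; exact/measurable_EFinP.
Qed.

Lemma ess_bounded_integrable D M h : measurable D -> (mu D < +oo)%E ->
  ess_bounded D M h -> mu.-integrable D (EFin \o h).
Proof.
move=> mD Doo hM; apply/integrableP; split.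
  by apply/measurable_EFinP; case: hM.
apply: le_lt_trans (ess_bounded_le_integral mD hM) _.
by case: hM => M0 _ _; rewrite lte_mul_pinfty.
Qed.

Lemma ess_bounded_le_Rintegral D M h : measurable D -> (mu D < +oo)%E ->
  ess_bounded D M h -> `|\int[mu]_(x in D) h x| <= M * fine (mu D).
Proof.
move=> mD Doo hM; have hint := ess_bounded_integrable mD Doo hM.
apply: le_trans (le_normr_Rintegral mD hint) _.
rewrite -lee_fin EFinM !fineK; first exact: ess_bounded_le_integral.
- by rewrite ge0_fin_numE.
- by rewrite ge0_fin_numE; [case/integrableP : hint|exact: integral_ge0].
Qed.

End ess_bounded.

(** * Integrals over segments for the completed Lebesgue measure *)

(** [R] with the sigma-algebra of all Lebesgue-measurable sets, on which [leb R] lives. *)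
Notation cara R := (caratheodory_type (@wlength R idfun)^*%mu).
Notation ess_bounded_itv x y := (ess_bounded (leb _) `[x, y]).

Section segint.
Variable R : realType.
Implicit Types (h k : R -> R) (x y z M N : R) (D : set R).

Lemma leb_itv x y : x <= y -> leb R `[x, y] = (y - x)%:E.
Proof.
move=> xy.
(* The Lebesgue measure and its completion are restrictions of one outer measure, so their values on
   a segment are convertible. *)
rewrite -[LHS]/(lebesgue_measure `[x, y]%classic) lebesgue_measure_itv /=.
by rewrite lte_fin; case: ltgtP xy => // ->; rewrite subrr.
Qed.

Lemma leb_itv_lty x y : (leb R `[x, y] < +oo)%E.
Proof.
have [xy|yx] := leP x y; first by rewrite leb_itv// ltry.
by rewrite set_itv_ge ?measure0// bnd_simp -ltNge.
Qed.

Lemma measurable_cara D : measurable D -> measurable (D : set (cara R)).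
Proof. exact: sub_caratheodory. Qed.

Lemma measurable_fun_cara D h : measurable D -> measurable_fun D h ->
  @measurable_fun _ _ (cara R) R D h.
Proof. by move=> mD mh _ B mB; apply: measurable_cara; exact: mh. Qed.

Lemma measurable_itv_cara (i : interval R) :
  measurable ([set` i] : set (cara R)).
Proof. exact: measurable_cara. Qed.

(** For [y < x] the segment is empty and the value is [0], not the oriented integral. *)
Definition segint h x y : R := \int[leb R]_(t in `[x, y]) h t.

Lemma integrable_itv M h x y :
  ess_bounded_itv x y M h -> (leb R).-integrable `[x, y] (EFin \o h).
Proof.
apply: ess_bounded_integrable; first exact: measurable_itv_cara.
exact: leb_itv_lty.
Qed.

Lemma ess_bounded_subitv M h x y x' y' : x <= x' -> y' <= y ->
  ess_bounded_itv x y M h -> ess_bounded_itv x' y' M h.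
Proof.
move=> xx' yy'; apply: ess_boundedS; first exact: measurable_itv_cara.
by apply: subset_itv; rewrite bnd_simp.
Qed.

Lemma segint_le M h x y : x <= y -> ess_bounded_itv x y M h ->
  `|segint h x y| <= M * (y - x).
Proof.
move=> xy hM; rewrite -[y - x]/(fine (y - x)%:E) -(leb_itv xy).
apply: ess_bounded_le_Rintegral hM; first exact: measurable_itv_cara.
exact: leb_itv_lty.
Qed.

Lemma segint_cst x y M : x <= y -> segint (fun=> M) x y = M * (y - x).
Proof.
move=> xy; rewrite /segint Rintegral_cst; last exact: measurable_itv_cara.
by rewrite -[y - x]/(fine (y - x)%:E) -(leb_itv xy).
Qed.

Lemma eq_segint h k x y : (forall t, x <= t <= y -> h t = k t) ->
  segint h x y = segint k x y.
Proof.
move=> hk; apply: eq_Rintegral => t; rewrite inE /= in_itv /=; exact: hk.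
Qed.

Lemma segintD M N h k x y :
  ess_bounded_itv x y M h -> ess_bounded_itv x y N k ->
  segint (fun t => h t + k t) x y = segint h x y + segint k x y.
Proof.
move=> hM kN; rewrite /segint RintegralD//; first exact: measurable_itv_cara.
- exact: integrable_itv hM.
- exact: integrable_itv kN.
Qed.

Lemma segintB M N h k x y :
  ess_bounded_itv x y M h -> ess_bounded_itv x y N k ->
  segint (fun t => h t - k t) x y = segint h x y - segint k x y.
Proof.
move=> hM kN; rewrite /segint RintegralB//; first exact: measurable_itv_cara.
- exact: integrable_itv hM.
- exact: integrable_itv kN.
Qed.

Lemma segintZ M h x y c : ess_bounded_itv x y M h ->
  segint (fun t => c * h t) x y = c * segint h x y.
Proof.
move=> hM; rewrite /segint RintegralZl//; first exact: measurable_itv_cara.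
exact: integrable_itv hM.
Qed.

(** The two closed segments share the point [y]: the union is split with []y, z]], and the null set
    [[y, y]] is then put back. *)
Lemma segint_cat M h x y z : x <= y -> y <= z -> ess_bounded_itv x z M h ->
  segint h x z = segint h x y + segint h y z.
Proof.
move=> xy yz hM.
have [xh yh] : ess_bounded_itv x y M h /\ ess_bounded_itv y z M h.
  by split; apply: ess_bounded_subitv hM.
have dxyz : [disjoint `[x, y]%classic & `]y, z]%classic].
  apply/disj_setPS => t [/=]; rewrite !in_itv/= => /andP[_ ty] /andP[].
  by rewrite ltNge ty.
have xyzE : `[x, z]%classic = `[x, y]%classic `|` `]y, z]%classic.
  by apply: itv_bndbnd_setU; rewrite bnd_simp.
have yzE : `]y, z]%classic = `[y, z]%classic `\` `[y, y]%classic.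
  apply/seteqP; split=> t /=; rewrite !in_itv /=.
    move=> /andP[yt tz]; rewrite (ltW yt) tz; split => //.
    by rewrite leNgt yt andbF.
  move=> [/andP[yt ->]] ty; rewrite andbT lt_neqAle yt andbT.
  by apply: contra_notN ty => /eqP ->; rewrite lexx.
rewrite /segint [in LHS]xyzE Rintegral_setU => //; last first.
  by rewrite -xyzE; exact: integrable_itv hM.
- exact: measurable_itv_cara.
- exact: measurable_itv_cara.
congr (_ + _); rewrite /Rintegral yzE -negligible_integral => //.
- exact: measurable_itv_cara.
- exact: measurable_itv_cara.
- exact: integrable_itv yh.
- by have := leb_itv (lexx y); rewrite subrr.
Qed.

End segint.

(** * Primitives *)

Section primitives.
Context (R : realType).
Implicit Types (p q x y K L M N : R) (h w v H W V : R -> R).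

(* Halving the segment [n] times improves the bound by the factor [2 ^ n]. *)
Lemma quadratic_increment_cst p q C H :
  (forall x y, p <= x -> x <= y -> y <= q ->
    `|H y - H x| <= C * (y - x) ^+ 2) ->
  forall x y, p <= x -> x <= y -> y <= q -> H y = H x.
Proof.
move=> HC.
have Hn n : forall x y, p <= x -> x <= y -> y <= q ->
    `|H y - H x| * 2 ^+ n <= C * (y - x) ^+ 2.
  elim: n => [|n IH] x y px xy yq; first by rewrite expr0 mulr1 HC.
  have /= := IH x ((x + y) / 2); have /= := IH ((x + y) / 2) y.
  move=> /(_ ltac:(lra) ltac:(lra) yq) h1 /(_ px ltac:(lra) ltac:(lra)) h2.
  have := ler_distD (H ((x + y) / 2)) (H y) (H x).
  rewrite -(ler_pM2r (exprn_gt0 n (@ltr0Sn R 1))) => h3.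
  rewrite exprS mulrCA.
  have -> : C * (y - x) ^+ 2 =
    2 * (C * (y - (x + y) / 2) ^+ 2 + C * ((x + y) / 2 - x) ^+ 2) by field.
  rewrite ler_pM2l//; apply: le_trans h3 _; rewrite mulrDl; exact: lerD.
move=> x y px xy yq; apply/eqP; rewrite -subr_eq0 -normr_eq0.
apply: contraT => neq0.
have e0 : 0 < `|H y - H x| by rewrite lt0r neq0 normr_ge0.
(* Any [n] above [C (y - x)^2 / |H y - H x|] contradicts [Hn], because [n < 2 ^ n]. *)
set n := (Num.truncn (`|H y - H x|^-1 * (C * (y - x) ^+ 2))).+1.
have := Hn n _ _ px xy yq; rewrite leNgt => /negP[]; rewrite -ltr_pdivrMl//.
apply: lt_trans (truncnS_gt _) _.
by rewrite -/n -natrX ltr_nat ltn_expl.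
Qed.

Definition lip_on p q L h : Prop :=
  forall x y, p <= x -> x <= y -> y <= q -> `|h y - h x| <= L * (y - x).

(** Increments instead of derivatives: for an [h] that is only measurable and essentially bounded,
    [H] is Lipschitz but may fail to be differentiable at some points. *)
Definition primitive_on p q h H : Prop :=
  forall x y, p <= x -> x <= y -> y <= q -> H y - H x = segint h x y.

Lemma lip_onP p q L h : lip_on p q L h ->
  forall x y, x \in `[p, q] -> y \in `[p, q] -> `|h y - h x| <= L * `|y - x|.
Proof.
move=> hL x y; rewrite !in_itv/= => /andP[px xq] /andP[py yq].
have [xy|/ltW yx] := leP x y.
  by rewrite [`|y - x|]ger0_norm ?subr_ge0// hL.
by rewrite distrC [`|y - x|]distrC [`|x - y|]ger0_norm ?subr_ge0// hL.
Qed.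

Lemma lip_on_continuous p q L h : lip_on p q L h ->
  {within `[p, q], continuous h}.
Proof.
move=> hL; apply/subspace_continuousP => x xpq.
apply/cvgrPdist_lt => e e0; near=> y.
have ypq : y \in `[p, q] by near: y; exact: withinT.
(* [L] may be zero or negative, hence the radius [e / (|L| + 1)]. *)
have L1 : 0 < `|L| + 1 by rewrite ltr_wpDl.
apply: le_lt_trans (lip_onP hL ypq xpq) _.
apply: (@le_lt_trans _ _ ((`|L| + 1) * `|x - y|)).
  by rewrite ler_wpM2r// (le_trans (ler_norm _))// lerDl.
rewrite mulrC -ltr_pdivlMr//; near: y.
apply: cvg_within; apply: (nbhsx_ballx x (e / (`|L| + 1))).
by rewrite divr_gt0.
Unshelve. all: by end_near. Qed.

Lemma lip_on_measurable p q L h : lip_on p q L h ->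
  @measurable_fun _ _ (cara R) R `[p, q] h.
Proof.
move=> hL; apply: measurable_fun_cara => //.
apply: subspace_continuous_measurable_fun => //.
exact: lip_on_continuous hL.
Qed.

Lemma lip_on_bounded p q L h : 0 <= L -> lip_on p q L h ->
  forall x, p <= x <= q -> `|h x| <= `|h p| + L * `|q - p|.
Proof.
move=> L0 hL x /andP[px xq].
rewrite -[h x](subrK (h p)) addrC (le_trans (ler_normD _ _))// lerD//.
apply: le_trans (hL _ _ _ px xq) _ => //; rewrite ler_wpM2l//.
by rewrite (le_trans _ (ler_norm _))// lerB.
Qed.

(** [|q - p|] rather than [q - p] keeps the bound nonnegative also when [q < p] and the segment is
    empty. *)
Lemma lip_on_ess_bounded p q L h : 0 <= L -> lip_on p q L h ->
  ess_bounded_itv p q (`|h p| + L * `|q - p|) h.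
Proof.
move=> L0 hL; apply: bounded_ess_bounded.
- by rewrite addr_ge0// mulr_ge0.
- exact: lip_on_measurable hL.
- by move=> x /=; rewrite in_itv/=; exact: lip_on_bounded.
Qed.

Lemma primitive_on_lip p q M w W : ess_bounded_itv p q M w ->
  primitive_on p q w W -> lip_on p q M W.
Proof.
move=> wM wW x y px xy yq; rewrite wW// segint_le//.
exact: ess_bounded_subitv wM.
Qed.

(* The densities [w] and [v] are only measurable, so the product need not be
   differentiable everywhere; instead, the difference between the two sides has
   increments of order [(y - x) ^ 2], hence is constant. *)
Lemma primitive_on_mul p q M N w v W V :
  ess_bounded_itv p q M w -> ess_bounded_itv p q N v ->
  primitive_on p q w W -> primitive_on p q v V ->
  primitive_on p q (fun t => w t * V t + W t * v t) (fun t => W t * V t).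
Proof.
move=> wM vN wW vV.
have WM := primitive_on_lip wM wW; have VN := primitive_on_lip vN vV.
have [M0 N0] := (ess_bounded_ge0 wM, ess_bounded_ge0 vN).
have WB := lip_on_ess_bounded M0 WM; have VB := lip_on_ess_bounded N0 VN.
have wVB := ess_boundedM wM VB; have WvB := ess_boundedM WB vN.
pose k t := w t * V t + W t * v t.
have kB : ess_bounded_itv p q _ k := ess_boundedD wVB WvB.
move=> x y px xy yq.
rewrite -/k; pose P z := W z * V z - segint k p z.
suff PE : P y = P x.
  have kxy : segint k p y = segint k p x + segint k x y.
    by apply: (segint_cat px xy); exact: ess_bounded_subitv kB.
  by move/(canRL (subrK _)): PE => ->; rewrite /P kxy; ring.
apply: (@quadratic_increment_cst p q (2 * M * N)) px xy yq => {}x {}y px xy yq.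
have sub : forall K h, ess_bounded_itv p q K h -> ess_bounded_itv x y K h.
  by move=> K h; exact: ess_bounded_subitv.
have -> : P y - P x = W y * V y - W x * V x - segint k x y.
  rewrite /P (segint_cat px xy (ess_bounded_subitv (lexx p) yq kB)); ring.
have wxy := sub _ _ wM; have vxy := sub _ _ vN.
have cstB c : ess_bounded_itv x y `|c| (fun=> c) by exact: ess_bounded_cst.
(* The increment of [W V] is [V x (W y - W x) + W y (V y - V x)]. After subtracting the integral of
   [k], each density is multiplied by an increment of the other factor, at most [N (y - x)] or
   [M (y - x)]; this yields the constant [2 M N]. *)
have -> : W y * V y - W x * V x - segint k x y =
  segint (fun t => (V x - V t) * w t + (W y - W t) * v t) x y.
  have -> : W y * V y - W x * V x = segint (fun t => V x * w t + W y * v t) x y.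
    rewrite (segintD (ess_boundedM (cstB _) wxy) (ess_boundedM (cstB _) vxy)).
    by rewrite (segintZ _ wxy) (segintZ _ vxy) -wW// -vV//; ring.
  have cB := ess_boundedD (ess_boundedM (cstB (V x)) wxy)
    (ess_boundedM (cstB (W y)) vxy).
  rewrite -(segintB cB (sub _ _ kB)).
  by apply: eq_segint => t _; rewrite /k; ring.
have -> : 2 * M * N * (y - x) ^+ 2 =
  (N * (y - x) * M + M * (y - x) * N) * (y - x) by ring.
apply: (segint_le xy).
apply: ess_boundedD (ess_boundedM _ wxy) (ess_boundedM _ vxy).
- apply: bounded_ess_bounded; first by rewrite mulr_ge0// subr_ge0.
    have [_ mVx _] := cstB (V x); have [_ mV _] := sub _ _ VB.
    exact: measurable_funB.
  move=> t /=; rewrite in_itv/= => /andP[xt ty]; rewrite distrC.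
  apply: le_trans (VN _ _ px xt (le_trans ty yq)) _.
  by rewrite ler_wpM2l// lerB.
- apply: bounded_ess_bounded; first by rewrite mulr_ge0// subr_ge0.
    have [_ mVx _] := cstB (W y); have [_ mV _] := sub _ _ WB.
    exact: measurable_funB.
  move=> t /=; rewrite in_itv/= => /andP[xt ty].
  apply: le_trans (WM _ _ (le_trans px xt) ty yq) _.
  by rewrite ler_wpM2l// lerB.
Qed.

(** Over [[x, y]] both [H] and the integral of the Lipschitz function [h] deviate from
    [h x * (y - x)] by at most [K (y - x)^2], so their difference is constant by
    [quadratic_increment_cst]. This serves as the fundamental theorem of calculus for explicit
    polynomials and for test functions. *)
Lemma primitive_on_taylor p q K h H : 0 <= K -> lip_on p q K h ->
  (forall x y, p <= x -> x <= y -> y <= q ->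
    `|H y - H x - h x * (y - x)| <= K * (y - x) ^+ 2) ->
  primitive_on p q h H.
Proof.
move=> K0 hK HK x y px xy yq.
have hB := lip_on_ess_bounded K0 hK.
pose P z := H z - segint h p z.
suff PE : P y = P x.
  move/(canRL (subrK _)): PE => ->; rewrite /P.
  rewrite (segint_cat px xy (ess_bounded_subitv (lexx p) yq hB)); ring.
apply: (@quadratic_increment_cst p q (K + K)) px xy yq => {}x {}y px xy yq.
have hxy := ess_bounded_subitv px yq hB.
have cstB : ess_bounded_itv x y `|h x| (fun=> h x) by exact: ess_bounded_cst.
have -> : P y - P x =
  H y - H x - h x * (y - x) - segint (fun t => h t - h x) x y.
  rewrite /P (segint_cat px xy (ess_bounded_subitv (lexx p) yq hB)).
  by rewrite (segintB hxy cstB) segint_cst//; ring.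
rewrite (le_trans (ler_normB _ _))// mulrDl lerD ?HK//.
rewrite expr2 mulrA; apply: (segint_le xy); apply: bounded_ess_bounded.
- by rewrite mulr_ge0// subr_ge0.
- have [_ mh _] := hxy; exact: measurable_funB.
move=> t /=; rewrite in_itv/= => /andP[xt ty].
apply: le_trans (hK _ _ px xt (le_trans ty yq)) _.
by rewrite ler_wpM2l// lerB.
Qed.

End primitives.

(** * The Neumann series *)

Section double_integral.
Context (R : realType).
Implicit Types (p q x y M N : R) (h k G : R -> R).

Lemma segint_xx M h x : ess_bounded_itv x x M h -> segint h x x = 0.
Proof.
move=> hM; apply/normr0_eq0/eqP; rewrite eq_le normr_ge0 andbT.
by have := segint_le (lexx x) hM; rewrite subrr mulr0.
Qed.

Lemma ler_norm_segint M N h G x y : ess_bounded_itv x y M h ->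
  ess_bounded_itv x y N G -> (forall t, x <= t <= y -> `|h t| <= G t) ->
  `|segint h x y| <= segint G x y.
Proof.
move=> hM GN hG; have mxy := @measurable_itv_cara R `[x, y].
have hI := integrable_itv hM; have GI := integrable_itv GN.
apply: le_trans (le_normr_Rintegral mxy hI) _.
by apply: (le_Rintegral mxy) => //; exact: integrable_norm.
Qed.

(** The common shape of [B_op], of [g_fun] up to sign, and of [a_seq] and [b_seq] from index [1],
    all convertible to it. It vanishes at [0], its derivative vanishes at [q], and its weak second
    derivative is [- h]. *)
Definition dblint q h x : R := segint (fun y => segint h y q) 0 x.

Lemma segint_tail_primitive p q M h : ess_bounded_itv p q M h ->
  primitive_on p q (fun t => - h t) (fun y => segint h y q).
Proof.
move=> hM x y px xy yq.
rewrite (segint_cat xy yq (ess_bounded_subitv px (lexx q) hM)).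
have -> : segint (fun t => - h t) x y = - segint h x y.
  rewrite -mulN1r -(segintZ (-1) (ess_bounded_subitv px yq hM)).
  by apply: eq_segint => t _; rewrite mulN1r.
ring.
Qed.

Lemma segint_tail_lip p q M h : ess_bounded_itv p q M h ->
  lip_on p q M (fun y => segint h y q).
Proof.
move=> hM.
exact: primitive_on_lip (ess_boundedN hM) (segint_tail_primitive hM).
Qed.

Lemma segint_tail_ess_bounded p q M h : ess_bounded_itv p q M h ->
  ess_bounded_itv p q (M * `|q - p|) (fun y => segint h y q).
Proof.
move=> hM; have M0 := ess_bounded_ge0 hM; apply: bounded_ess_bounded.
- by rewrite mulr_ge0.
- exact: lip_on_measurable (segint_tail_lip hM).
move=> x /=; rewrite in_itv/= => /andP[px xq].
apply: le_trans (segint_le xq (ess_bounded_subitv px (lexx q) hM)) _.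
by rewrite ler_wpM2l// (le_trans _ (ler_norm _))// lerB.
Qed.

Lemma dblint_primitive q M h : ess_bounded_itv 0 q M h ->
  primitive_on 0 q (fun y => segint h y q) (dblint q h).
Proof.
move=> hM x y x0 xy yq; rewrite /dblint.
have VB := ess_bounded_subitv (lexx 0) yq (segint_tail_ess_bounded hM).
by rewrite (segint_cat x0 xy VB) addrC addrA addNr add0r.
Qed.

Lemma dblint_measurable q M h : ess_bounded_itv 0 q M h ->
  @measurable_fun _ _ (cara R) R `[0, q] (dblint q h).
Proof.
move=> hM; apply: lip_on_measurable.
exact: primitive_on_lip (segint_tail_ess_bounded hM) (dblint_primitive hM).
Qed.

(** The uniform bound [M q] for the tail integral would lose the factor [1 / 2] on which the
    smallness condition depends. The bound [G y = M (q - y)] keeps it, and [H] is an explicit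
    primitive of [G]. *)
Lemma dblint_le q M h x : ess_bounded_itv 0 q M h -> 0 <= x <= q ->
  `|dblint q h x| <= M * (q ^+ 2 / 2).
Proof.
move=> hM /andP[x0 xq]; have M0 := ess_bounded_ge0 hM.
have VB := ess_bounded_subitv (lexx 0) xq (segint_tail_ess_bounded hM).
pose G y := M * (q - y); pose H y := M * (q * y - y ^+ 2 / 2).
have Glip : lip_on 0 q M G.
  move=> y z _ yz _; rewrite /G -mulrBr normrM ger0_norm// ler_wpM2l//.
  by rewrite -normrN ger0_norm; lra.
have GH : primitive_on 0 q G H.
  apply: (primitive_on_taylor M0 Glip) => y z y0 yz zq.
  have -> : H z - H y - G y * (z - y) = - (M / 2 * (z - y) ^+ 2).
    by rewrite /H /G; field.
  rewrite normrN ger0_norm; last by rewrite mulr_ge0 ?sqr_ge0// divr_ge0.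
  by rewrite ler_wpM2r ?sqr_ge0//; lra.
have GB := ess_bounded_subitv (lexx 0) xq (lip_on_ess_bounded M0 Glip).
apply: le_trans (ler_norm_segint VB GB _) _.
  move=> t /andP[t0 tx]; have tq := le_trans tx xq.
  exact: segint_le tq (ess_bounded_subitv t0 (lexx q) hM).
(* Here [q x - x^2 / 2 = (q^2 - (q - x)^2) / 2]. *)
rewrite -GH// /H -mulrBr ler_wpM2l//; have := sqr_ge0 (q - x); nra.
Qed.

Lemma dblint0 q M h : 0 <= q -> ess_bounded_itv 0 q M h -> dblint q h 0 = 0.
Proof.
move=> q0 hM; apply: segint_xx.
exact: ess_bounded_subitv (lexx 0) q0 (segint_tail_ess_bounded hM).
Qed.

Lemma dblintD q M N h k x :
  ess_bounded_itv 0 q M h -> ess_bounded_itv 0 q N k ->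
  x <= q ->
  dblint q (fun t => h t + k t) x = dblint q h x + dblint q k x.
Proof.
move=> hM kN xq; rewrite /dblint.
have hV := ess_bounded_subitv (lexx 0) xq (segint_tail_ess_bounded hM).
have kV := ess_bounded_subitv (lexx 0) xq (segint_tail_ess_bounded kN).
rewrite -(segintD hV kV); apply: eq_segint => y /andP[y0 yx].
exact: segintD (ess_bounded_subitv y0 (lexx q) hM)
  (ess_bounded_subitv y0 (lexx q) kN).
Qed.

Lemma dblintZ q M c h x : ess_bounded_itv 0 q M h -> x <= q ->
  dblint q (fun t => c * h t) x = c * dblint q h x.
Proof.
move=> hM xq; rewrite /dblint.
have hV := ess_bounded_subitv (lexx 0) xq (segint_tail_ess_bounded hM).
rewrite -(segintZ c hV); apply: eq_segint => y /andP[y0 yx].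
exact: segintZ (ess_bounded_subitv y0 (lexx q) hM).
Qed.

Lemma dblintB q M N h k x :
  ess_bounded_itv 0 q M h -> ess_bounded_itv 0 q N k ->
  x <= q ->
  dblint q (fun t => h t - k t) x = dblint q h x - dblint q k x.
Proof.
move=> hM kN xq; rewrite (dblintD hM (ess_boundedN kN))//; congr (_ + _).
have -> : (fun t => - k t) = (fun t => -1 * k t).
  by apply/funext => t; rewrite mulN1r.
by rewrite (dblintZ _ kN xq) mulN1r.
Qed.

End double_integral.

(** * The operator [B] as a contraction, and its Neumann series *)

Section neumann_series.
Context (R : realType) (q A : R) (a : R -> R).
Hypotheses (aA : ess_bounded_itv 0 q A a) (Aq : A * q ^+ 2 < 2).
Implicit Types (C x : R) (u v : R -> R).

Local Notation B := (B_op a q).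
Local Notation r := (A * (q ^+ 2 / 2)).

(** The bound holds at every point, not just almost everywhere, because the Neumann series is summed
    and estimated pointwise. *)
Definition bounded_measurable C u : Prop :=
  [/\ 0 <= C, @measurable_fun _ _ (cara R) R `[0, q] u &
      forall x, 0 <= x <= q -> `|u x| <= C].

Lemma bounded_measurable_ess C u : bounded_measurable C u ->
  ess_bounded_itv 0 q C u.
Proof. by move=> [C0 mu uC]; exact: bounded_ess_bounded. Qed.

Lemma bounded_measurableD C C' u v :
  bounded_measurable C u -> bounded_measurable C' v ->
  bounded_measurable (C + C') (fun t => u t + v t).
Proof.
move=> [C0 mu uC] [C0' mv vC]; split; first exact: addr_ge0.
  exact: measurable_funD.
by move=> x xq; rewrite (le_trans (ler_normD _ _))// lerD// ?uC ?vC.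
Qed.

Lemma bounded_measurableZ c C u : bounded_measurable C u ->
  bounded_measurable (`|c| * C) (fun t => c * u t).
Proof.
move=> [C0 mu uC]; split; first exact: mulr_ge0.
  by apply: measurable_funM.
by move=> x xq; rewrite normrM ler_wpM2l// uC.
Qed.

Lemma eq_bounded_measurable C u v : (forall x, 0 <= x <= q -> u x = v x) ->
  bounded_measurable C v -> bounded_measurable C u.
Proof.
move=> uv [C0 mv vC]; split => //; last by move=> x xq; rewrite uv// vC.
by apply: eq_measurable_fun mv => x; rewrite inE/= in_itv/= => /uv.
Qed.

Lemma mul_coef_ess C u : bounded_measurable C u ->
  ess_bounded_itv 0 q (A * C) (fun t => a t * u t).
Proof. by move=> /bounded_measurable_ess; exact: ess_boundedM. Qed.

Lemma eq_B_op u v x : (forall t, 0 <= t <= q -> u t = v t) -> 0 <= x <= q ->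
  B u x = B v x.
Proof.
move=> uv /andP[_ xq]; apply: eq_segint => y /andP[y0 _].
by apply: eq_segint => t /andP[yt tq]; rewrite uv// tq (le_trans y0 yt).
Qed.

Lemma B_opD C C' u v x : bounded_measurable C u -> bounded_measurable C' v ->
  0 <= x <= q -> B (fun t => u t + v t) x = B u x + B v x.
Proof.
move=> uC vC /andP[_ xq].
rewrite -[RHS](dblintD (mul_coef_ess uC) (mul_coef_ess vC) xq).
by congr (dblint q _ x); apply/funext => t; rewrite mulrDr.
Qed.

Lemma B_opZ c C u x : bounded_measurable C u ->
  0 <= x <= q -> B (fun t => c * u t) x = c * B u x.
Proof.
move=> uC /andP[_ xq].
rewrite -[RHS](dblintZ c (mul_coef_ess uC) xq).
by congr (dblint q _ x); apply/funext => t; rewrite mulrCA.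
Qed.

Lemma ratio_ge0 : 0 <= r.
Proof. by rewrite mulr_ge0 ?(ess_bounded_ge0 aA)// divr_ge0 ?sqr_ge0. Qed.

Lemma ratio_lt1 : r < 1.
Proof. by rewrite mulrA ltr_pdivrMr// mul1r. Qed.

Lemma B_op_bounded_measurable C u : bounded_measurable C u ->
  bounded_measurable (C * r) (B u).
Proof.
move=> uC; have auC := mul_coef_ess uC; split.
- by case: uC => C0 _ _; rewrite mulr_ge0 ?ratio_ge0.
- exact: (dblint_measurable auC).
- move=> x xq; rewrite mulrA [C * A]mulrC; exact: (dblint_le auC).
Qed.

Lemma iter_B_op_bounded_measurable C v k : bounded_measurable C v ->
  bounded_measurable (C * r ^+ k) (iter k B v).
Proof.
move=> vC; elim: k => [|k IH]; first by rewrite expr0 mulr1.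
by rewrite exprSr mulrA iterS; exact: B_op_bounded_measurable.
Qed.

Definition neumann_sum v (n : nat) x := \sum_(0 <= k < n) iter k B v x.

Definition neumann v x := limn (fun n => neumann_sum v n x).

Lemma neumann_sum0 v x : neumann_sum v 0 x = 0.
Proof. by rewrite /neumann_sum big_geq. Qed.

Lemma neumann_sum_recr v n x :
  neumann_sum v n.+1 x = neumann_sum v n x + iter n B v x.
Proof. by rewrite /neumann_sum big_nat_recr. Qed.

(** The term of index [k] is at most [C r^k]; multiplied by [1 - r], these bounds telescope. *)
Lemma neumann_sum_tail C v n m x : bounded_measurable C v -> 0 <= x <= q ->
  `|neumann_sum v (n + m) x - neumann_sum v n x| * (1 - r) <=
    C * (r ^+ n - r ^+ (n + m)).
Proof.
move=> vC xq; elim: m => [|m IH].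
  by rewrite addn0 !subrr normr0 mul0r mulr0.
rewrite addnS neumann_sum_recr addrAC.
have [_ _ /(_ _ xq) h] := iter_B_op_bounded_measurable (n + m) vC.
have r1 : 0 <= 1 - r by rewrite subr_ge0 ltW// ratio_lt1.
apply: (@le_trans _ _
  (C * (r ^+ n - r ^+ (n + m)) + C * r ^+ (n + m) * (1 - r))).
  apply: le_trans (ler_wpM2r r1 (ler_normD _ _)) _.
  by rewrite mulrDl lerD// ler_wpM2r.
by rewrite [r ^+ _.+1]exprS le_eqVlt; apply/orP; left; apply/eqP; ring.
Qed.

Lemma neumann_sum_tail_le C v n m x : bounded_measurable C v -> 0 <= x <= q ->
  `|neumann_sum v (n + m) x - neumann_sum v n x| <= C / (1 - r) * r ^+ n.
Proof.
move=> vC xq; have r1 : 0 < 1 - r by rewrite subr_gt0 ratio_lt1.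
rewrite mulrAC ler_pdivlMr//; apply: le_trans (neumann_sum_tail n m vC xq) _.
by case: vC => C0 _ _; rewrite ler_wpM2l// gerBl exprn_ge0// ratio_ge0.
Qed.

Lemma geometric_bound_cvg0 C (e : nat -> R) :
  (forall n, `|e n| <= C * r ^+ n) -> e n @[n --> \oo] --> 0.
Proof.
move=> eC; apply/norm_cvg0P.
apply: (@squeeze_cvgr _ _ _ _ (fun=> 0) (fun n => C * r ^+ n)).
- by near=> n; rewrite normr_ge0 eC.
- exact: cvg_cst.
- apply: cvg_geometric; rewrite ger0_norm ?ratio_lt1//; exact: ratio_ge0.
Unshelve. all: by end_near. Qed.

Lemma neumann_cvg C v x : bounded_measurable C v -> 0 <= x <= q ->
  neumann_sum v n x @[n --> \oo] --> neumann v x.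
Proof.
move=> vC xq; apply: (@normed_cvg _ _ (fun k => iter k B v x)).
apply: (@series_le_cvg _ _ (fun k => C * r ^+ k)).
- by move=> n; exact: normr_ge0.
- by case: vC => C0 _ _ n; rewrite mulr_ge0// exprn_ge0// ratio_ge0.
- by move=> n; have [_ _] := iter_B_op_bounded_measurable n vC; exact.
- apply: is_cvg_geometric_series.
  by rewrite ger0_norm ?ratio_lt1// ratio_ge0.
Qed.

(** The limit [m --> oo] in [neumann_sum_tail_le]. The bound is uniform in [x], which lets
    [neumannE] pass the limit through [B]. *)
Lemma neumann_tail_le C v n x : bounded_measurable C v -> 0 <= x <= q ->
  `|neumann v x - neumann_sum v n x| <= C / (1 - r) * r ^+ n.
Proof.
move=> vC xq.
have h : `|neumann_sum v (m + n) x - neumann_sum v n x| @[m --> \oo] -->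
    `|neumann v x - neumann_sum v n x|.
  apply: cvg_norm; apply: cvgB; last exact: cvg_cst.
  rewrite (cvg_shiftn n (fun m => neumann_sum v m x)).
  exact: neumann_cvg vC xq.
rewrite -(cvg_lim _ h)//; apply: limr_le.
  by apply/cvg_ex; eexists; exact: h.
by near=> m; rewrite addnC; exact: neumann_sum_tail_le.
Unshelve. all: by end_near. Qed.

Lemma neumann_sum_bounded_measurable C v n : bounded_measurable C v ->
  bounded_measurable (C / (1 - r)) (neumann_sum v n).
Proof.
move=> vC; split.
- by case: vC => C0 _ _; rewrite divr_ge0// subr_ge0 ltW// ratio_lt1.
- elim: n => [|n IH].
    rewrite (_ : neumann_sum v 0 = fun=> 0); first exact: measurable_cst.
    by apply/funext => x; rewrite neumann_sum0.
  rewrite (_ : neumann_sum v n.+1 = neumann_sum v n \+ iter n B v).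
    apply: measurable_funD => //.
    by have [_] := iter_B_op_bounded_measurable n vC.
  by apply/funext => x; rewrite neumann_sum_recr.
- move=> x xq; have := neumann_sum_tail_le 0 n vC xq.
  by rewrite neumann_sum0 subr0 expr0 mulr1 add0n.
Qed.

Lemma neumann_bounded_measurable C v : bounded_measurable C v ->
  bounded_measurable (C / (1 - r)) (neumann v).
Proof.
move=> vC; split.
- by case: vC => C0 _ _; rewrite divr_ge0// subr_ge0 ltW// ratio_lt1.
- have ms n : @measurable_fun _ _ (cara R) R `[0, q] (neumann_sum v n).
    by have [_] := neumann_sum_bounded_measurable n vC.
  have cs x : `[0, q]%classic x ->
      neumann_sum v n x @[n --> \oo] --> neumann v x.
    by rewrite /= in_itv/= => xq; exact: neumann_cvg vC xq.
  exact: (measurable_fun_cvg ms cs).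
- move=> x xq; have := neumann_tail_le 0 vC xq.
  by rewrite neumann_sum0 subr0 expr0 mulr1.
Qed.

Lemma neumann_sumS C v n x : bounded_measurable C v -> 0 <= x <= q ->
  neumann_sum v n.+1 x = v x + B (neumann_sum v n) x.
Proof.
move=> vC xq; elim: n => [|n IH].
  rewrite neumann_sum_recr neumann_sum0 add0r (_ : B _ x = 0) ?addr0//.
  (* The empty sum has bound [0], so [B_op_bounded_measurable] gives its image the bound [0 * r]. *)
  have s0 : bounded_measurable 0 (neumann_sum v 0).
    have [_ ms _] := neumann_sum_bounded_measurable 0 vC; split=> // t _.
    by rewrite neumann_sum0 normr0.
  have [_ _ /(_ _ xq)] := B_op_bounded_measurable s0.
  by rewrite mul0r normr_le0 => /eqP.
rewrite neumann_sum_recr IH iterS -addrA; congr (_ + _).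
rewrite -(B_opD (neumann_sum_bounded_measurable n vC)
  (iter_B_op_bounded_measurable n vC) xq).
by congr (B _ x); apply/funext => t; rewrite neumann_sum_recr.
Qed.

(** This is the limit of [neumann_sumS]. The defect [e] of the equation does not depend on [n], yet
    it is at most a constant times [r^n] for every [n], so it is zero. *)
Lemma neumannE C v x : bounded_measurable C v -> 0 <= x <= q ->
  neumann v x = v x + B (neumann v) x.
Proof.
move=> vC xq; apply/eqP; rewrite -subr_eq0; apply/eqP.
have SC := neumann_bounded_measurable vC.
set e := neumann v x - _.
suff e0 : (fun=> e : R) n @[n --> \oo] --> 0.
  by rewrite -(cvg_lim _ e0)// lim_cst.
(* One half of the constant comes from the tail at [n.+1], the other from [B] applied to the tail at
   [n]; each contributes a factor [r]. *)
apply: (@geometric_bound_cvg0 (2 * (C / (1 - r) * r))) => n.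
have sC := neumann_sum_bounded_measurable n vC.
have NsC := bounded_measurableZ (-1) sC.
have dC : bounded_measurable (C / (1 - r) * r ^+ n)
    (fun t => neumann v t + -1 * neumann_sum v n t).
  have [_ md _] := bounded_measurableD SC NsC; split => //.
  - by case: SC => ? _ _; rewrite mulr_ge0// exprn_ge0// ratio_ge0.
  - by move=> t tq; rewrite mulN1r; exact: neumann_tail_le.
have [_ _ /(_ _ xq) BdC] := B_op_bounded_measurable dC.
rewrite (B_opD SC NsC xq) (B_opZ _ sC xq) mulN1r in BdC.
have := neumann_tail_le n.+1 vC xq; rewrite (neumann_sumS n vC xq) => Sn.
have aux (s t b c : R) : s - (t + b) = s - (t + c) - (b - c) by ring.
have -> : e =
  (neumann v x - (v x + B (neumann_sum v n) x)) -
  (B (neumann v) x - B (neumann_sum v n) x).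
  exact: aux.
apply: le_trans (ler_normB _ _) _; apply: le_trans (lerD Sn BdC) _.
by rewrite [r ^+ _.+1]exprS le_eqVlt; apply/orP; left; apply/eqP; ring.
Qed.

(** Brings [I1] and [I2] to Neumann form. The sequences agree only from index [1]: at [0], [a_seq]
    and [b_seq] are [0] while the iterate is [v], which is added separately. *)
Lemma neumann_from1 C v (s : nat -> R -> R) x :
  bounded_measurable C v -> 0 <= x <= q -> (forall k, s k.+1 = iter k.+1 B v) ->
  v x + limn (fun n => \sum_(1 <= k < n) s k x) = neumann v x.
Proof.
move=> vC xq sE.
suff h : \sum_(1 <= k < n) s k x @[n --> \oo] --> neumann v x - v x.
  by rewrite (cvg_lim _ h)// addrC subrK.
rewrite -cvg_shiftS /=.
have -> : (fun n => \sum_(1 <= k < n.+1) s k x) =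
    (fun n => neumann_sum v n.+1 x - v x).
  apply/funext => n; rewrite /neumann_sum [in RHS]big_nat_recl//=.
  rewrite addrAC subrr add0r.
  by rewrite big_add1; apply: eq_bigr => k _; rewrite sE.
apply: cvgB; last exact: cvg_cst.
by rewrite (cvg_shiftS (fun n => neumann_sum v n x)); exact: neumann_cvg vC xq.
Qed.

End neumann_series.

Lemma a_seqS (R : realType) (a : R -> R) (q : R) k :
  a_seq a q k.+1 = iter k.+1 (B_op a q) id.
Proof.
elim: k => [|k IH]; apply/funext => x.
  rewrite -[RHS]/(dblint q (fun t => a t * t) x).
  by congr (dblint q _ x); apply/funext => t; rewrite mulrC.
by rewrite iterS -IH.
Qed.

Lemma b_seqS (R : realType) (a : R -> R) (q : R) k :
  b_seq a q k.+1 = iter k.+1 (B_op a q) (fun=> 1).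
Proof.
elim: k => [|k IH]; apply/funext => x.
  rewrite -[RHS]/(dblint q (fun t => a t * 1) x).
  by congr (dblint q _ x); apply/funext => t; rewrite mulr1.
by rewrite iterS -IH.
Qed.

(** * Classical and weak derivatives *)

Section derivatives.
Context (R : realType).
Implicit Types (p q x y K M N : R) (h w H u U phi : R -> R).

Lemma lagrange H x y : (forall t, derivable H t 1) -> x <= y ->
  exists2 c, x <= c <= y & H y - H x = derive1 H c * (y - x).
Proof.
move=> dH; rewrite le_eqVlt => /predU1P[->|xy].
  by exists y; rewrite ?lexx// !subrr mulr0.
have [||c /itvP cxy HE] := @MVT _ H (derive1 H) x y xy.
- by move=> t _; rewrite derive1E; exact: derivableP.
- by apply: derivable_within_continuous => t _; exact: dH.
- by exists c => //; rewrite !cxy.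
Qed.

(** The constant is the maximum over [[p, q]] of the absolute value of the derivative, which is
    continuous. This makes test functions and their derivatives amenable to the Lipschitz lemmas. *)
Lemma derivable_lip_on p q h : (forall t, derivable h t 1) ->
  (forall t, derivable (derive1 h) t 1) -> p <= q ->
  exists2 K, 0 <= K & lip_on p q K h.
Proof.
move=> dh ddh pq.
have [|c _ cM] := @EVT_max _ (fun t => `|derive1 h t|) p q pq.
  apply: continuous_subspaceT => t; apply: cvg_norm.
  exact/differentiable_continuous/derivable1_diffP.
exists `|derive1 h c| => // x y px xy yq.
have [s /andP[xs sy] ->] := lagrange dh xy.
rewrite normrM [`|y - x|]ger0_norm ?subr_ge0// ler_wpM2r ?subr_ge0//.
by apply: cM; rewrite in_itv/= (le_trans px xs) (le_trans sy yq).
Qed.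

(** A mean value point [c] turns the first-order Taylor remainder into [(H' c - H' x) (y - x)],
    which the Lipschitz bound makes quadratic. *)
Lemma derive1_primitive p q K H : 0 <= K -> (forall t, derivable H t 1) ->
  lip_on p q K (derive1 H) -> primitive_on p q (derive1 H) H.
Proof.
move=> K0 dH HK; apply: (primitive_on_taylor K0 HK) => x y px xy yq.
have [c /andP[xc cy] ->] := lagrange dH xy.
rewrite -mulrBl normrM [`|y - x|]ger0_norm ?subr_ge0// expr2 mulrA.
rewrite ler_wpM2r ?subr_ge0//.
by apply: le_trans (HK _ _ px xc (le_trans cy yq)) _; rewrite ler_wpM2l// lerB.
Qed.

Lemma primitive_on_remainder p q K h H : 0 <= K -> lip_on p q K h ->
  primitive_on p q h H -> forall x y, x \in `[p, q] -> y \in `[p, q] ->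
  `|H y - H x - h x * (y - x)| <= K * `|y - x| * `|y - x|.
Proof.
move=> K0 hK hH.
(* The slope [c] is left free so that it can be the value of [h] at the left end of the segment or
   at the right end, according to the order of the two points. *)
have key x y c : p <= x -> x <= y -> y <= q ->
    (forall t, x <= t <= y -> `|h t - c| <= K * (y - x)) ->
    `|H y - H x - c * (y - x)| <= K * (y - x) * (y - x).
  move=> px xy yq hc.
  have hxy := ess_bounded_subitv px yq (lip_on_ess_bounded K0 hK).
  have cB : ess_bounded_itv x y `|c| (fun=> c) by exact: ess_bounded_cst.
  rewrite hH// -(segint_cst c xy) -(segintB hxy cB); apply: (segint_le xy).
  apply: bounded_ess_bounded.
  - by rewrite mulr_ge0// subr_ge0.
  - have [_ mh _] := hxy; exact: measurable_funB.
  - by move=> t /=; rewrite in_itv/=; exact: hc.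
move=> x y; rewrite !in_itv/= => /andP[px xq] /andP[py yq].
have [xy|/ltW yx] := leP x y.
  rewrite [`|y - x|]ger0_norm ?subr_ge0//; apply: key => // t /andP[xt ty].
  apply: le_trans (hK _ _ px xt (le_trans ty yq)) _.
  by rewrite ler_wpM2l// lerB.
have -> : H y - H x - h x * (y - x) = - (H x - H y - h x * (x - y)) by ring.
rewrite normrN [`|y - x|]distrC [`|x - y|]ger0_norm ?subr_ge0//.
apply: key => // t /andP[yt tx]; rewrite distrC.
by apply: le_trans (hK _ _ (le_trans py yt) tx xq) _; rewrite ler_wpM2l// lerB.
Qed.

Lemma primitive_is_derive_on q K h H x : 0 <= K -> lip_on 0 q K h ->
  primitive_on 0 q h H -> x \in `[0, q] -> is_derive_on q H x (h x).
Proof.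
move=> K0 hK hH xq; apply/cvgrPdist_lt => e e0.
have K1 : 0 < K + 1 by rewrite ltr_wpDl.
have : \forall y \near x, `|x - y| < e / (K + 1).
  by apply: (nbhsx_ballx x (e / (K + 1))); rewrite divr_gt0.
move=> near_x; rewrite near_withinE /dnbhs near_withinE.
apply: filterS near_x => y xy_lt /eqP/eqP yx yq.
have d0 : 0 < `|y - x| by rewrite normr_gt0 subr_eq0.
have := primitive_on_remainder K0 hK hH xq yq.
have -> : h x - (H y - H x) / (y - x) =
    - ((H y - H x - h x * (y - x)) / (y - x)).
  by field; rewrite subr_eq0.
rewrite normrN normrM normfV -ler_pdivrMr// => /le_lt_trans; apply.
rewrite distrC in xy_lt.
apply: (@le_lt_trans _ _ ((K + 1) * `|y - x|)).
  by rewrite ler_wpM2r// lerDl.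
by rewrite mulrC -ltr_pdivlMr.
Qed.

(** The complement of the support is open, so [phi] vanishes on a whole neighbourhood of [x]. This
    removes the boundary terms in the integration by parts. *)
Lemma test_function_endpoint q phi x :
  test_function q phi -> x \notin `]0, q[ ->
  phi x = 0 /\ derive1 phi x = 0.
Proof.
move=> [_ _ supp] xq.
have xsupp : (~` closure [set y | phi y != 0]) x.
  by move=> /supp /=; apply/negP.
have phi0 : \forall y \near x, phi y = cst 0 y.
  have : nbhs x (~` closure [set y | phi y != 0]).
    by apply: open_nbhs_nbhs; split => //; exact/closed_openC/closed_closure.
  apply: filterS => y /= ny; apply: contrapT => /eqP py; apply: ny.
  exact: subset_closure.
split; first exact: nbhs_singleton phi0.
by rewrite derive1E (near_eq_derive _ phi0) derive_cst.
Qed.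

Lemma ess_bounded_loc_integrable q M h : ess_bounded_itv 0 q M h ->
  loc_integrable `]0, q[ h.
Proof.
move=> hM K Kq cK.
have mK : measurable (K : set (cara R)).
  apply: measurable_cara; apply: closed_measurable.
  exact: compact_closed cK.
apply: integrableS (integrable_itv hM) => //; first exact: measurable_itv_cara.
by apply: subset_trans Kq _; exact: subset_itv_oo_cc.
Qed.

(** The products [u phi'] and [U phi] vanish at both end points, so by [primitive_on_mul] the
    integrals of [u phi''] and of [w phi] both equal minus the integral of [U phi']. *)
Lemma primitive_weak_derive2 q M N u U w : 0 <= q ->
  ess_bounded_itv 0 q M w -> ess_bounded_itv 0 q N U ->
  primitive_on 0 q w U -> primitive_on 0 q U u ->
  is_weak_derive2 q u w.
Proof.
move=> q0 wM UN wU Uu.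
have u_lip := primitive_on_lip UN Uu.
have uB := lip_on_ess_bounded (ess_bounded_ge0 UN) u_lip.
split; first exact: ess_bounded_loc_integrable uB.
  exact: ess_bounded_loc_integrable wM.
move=> phi tphi.
have [p0 p0'] : phi 0 = 0 /\ derive1 phi 0 = 0.
  by apply: (test_function_endpoint tphi); rewrite in_itv/= ltxx.
have [pq pq'] : phi q = 0 /\ derive1 phi q = 0.
  by apply: (test_function_endpoint tphi); rewrite in_itv/= ltxx andbF.
have [dphi _ _] := tphi.
have [K1 K10 lip1] := derivable_lip_on (dphi 1%N) (dphi 2%N) q0.
have [K2 K20 lip2] := derivable_lip_on (dphi 2%N) (dphi 3%N) q0.
have B1 := lip_on_ess_bounded K10 lip1; have B2 := lip_on_ess_bounded K20 lip2.
have prim1 := derive1_primitive K10 (dphi 0%N) lip1.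
have prim2 := derive1_primitive K20 (dphi 1%N) lip2.
have phi_lip := primitive_on_lip B1 prim1.
have B0 := lip_on_ess_bounded (ess_bounded_ge0 B1) phi_lip.
have := primitive_on_mul UN B2 Uu prim2 (lexx 0) q0 (lexx q).
have := primitive_on_mul wM B1 wU prim1 (lexx 0) q0 (lexx q).
rewrite (segintD (ess_boundedM wM B0) (ess_boundedM UN B1)).
rewrite (segintD (ess_boundedM UN B1) (ess_boundedM uB B2)).
rewrite /= p0 p0' pq pq' !mulr0 subrr => E1 E2.
rewrite -[LHS]/(segint (fun t => u t * derive1 (derive1 phi) t) 0 q).
rewrite -[RHS]/(segint (fun t => w t * phi t) 0 q).
apply: (@addrI _ (segint (fun t => U t * derive1 phi t) 0 q)).
by rewrite -E2 addrC -E1.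
Qed.

Lemma ess_bounded_S_space q M h : ess_bounded_itv 0 q M h -> S_space q h.
Proof.
move=> [M0 mh hM]; split => //.
apply: (@le_lt_trans _ _ M%:E); last exact: ltry.
apply/ess_supP; apply: filterS hM => x hx; rewrite patchE.
by case: ifPn => [/set_mem/hx|_]; rewrite lee_fin.
Qed.

(** The bound is the norm itself, so that the smallness condition on [S_norm] carries over to it. *)
Lemma S_space_ess_bounded q h : 0 <= q -> S_space q h ->
  exists2 M, S_norm q h = M%:E & ess_bounded_itv 0 q M h.
Proof.
move=> q0 [mh hoo].
have nonneg : (0 <= S_norm q h)%E.
  apply: ess_sup_gee; last first.
    by apply: aeW => x; rewrite patchE; case: ifP.
  (* A nonnegative function has nonnegative essential supremum once the whole space has positive
     measure, which [[0, 1]] witnesses. *)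
  apply: (@lt_le_trans _ _ (leb R `[0, 1])).
    by rewrite leb_itv// subr0 lte01.
  apply: le_measure => //; rewrite inE; first exact: measurable_itv_cara.
  exact: measurableT.
have hE : S_norm q h = (fine (S_norm q h))%:E by rewrite fineK// ge0_fin_numE.
exists (fine (S_norm q h)) => //; split => //; first exact: fine_ge0.
have := ess_sup_ge (leb R) (patch (fun=> 0%E) `[0, q] (fun x => `|h x|%:E)).
apply: filterS => x; rewrite -/(S_norm q h) hE patchE => + xq.
by rewrite mem_set// lee_fin.
Qed.

End derivatives.

(** * The boundary value problem *)

Section bvp.
Context (R : realType).
Implicit Types (q x A M N : R) (a f u U w : R -> R).

Lemma primitive_bvp_solution a f q alpha M N u U : 0 < q ->
  ess_bounded_itv 0 q M (fun t => f t - a t * u t) ->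
  lip_on 0 q N U -> 0 <= N ->
  primitive_on 0 q (fun t => f t - a t * u t) U -> primitive_on 0 q U u ->
  u 0 = alpha -> bvp_solution a f q alpha (U q) u.
Proof.
move=> q0 wM UN N0 wU Uu u0.
have weak : is_weak_derive2 q u (fun t => f t - a t * u t).
  exact: primitive_weak_derive2 (ltW q0) wM (lip_on_ess_bounded N0 UN) wU Uu.
split => //.
- exists (fun t => f t - a t * u t); first exact: weak.
  exact: ess_bounded_S_space wM.
- exists U; first exact: lip_on_continuous UN.
  by move=> x xq; exact: primitive_is_derive_on N0 UN Uu xq.
- exists (fun t => f t - a t * u t); first exact: weak.
  by apply: aeW => x _; rewrite subrK.
- apply: (primitive_is_derive_on N0 UN Uu).
  by rewrite in_itv/= lexx (ltW q0).
Qed.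

Lemma integral_equation_bvp_solution a f q alpha beta A N C u : 0 < q ->
  ess_bounded_itv 0 q A a -> ess_bounded_itv 0 q N f ->
  bounded_measurable q C u ->
  (forall x, 0 <= x <= q ->
    u x = alpha + beta * x + g_fun f q x + B_op a q u x) ->
  bvp_solution a f q alpha beta u.
Proof.
move=> q0 aA fN uC uE.
have auB := mul_coef_ess aA uC; have wB := ess_boundedB fN auB.
pose w t := f t - a t * u t.
(* The candidate for [u']: the primitive of [w] with value [beta] at [q]. *)
pose U y := beta - segint w y q.
have VN : lip_on 0 q (N + A * C) (fun y => segint w y q) := segint_tail_lip wB.
have M0 := ess_bounded_ge0 wB.
have UN : lip_on 0 q (N + A * C) U.
  move=> x y x0 xy yq; have := VN _ _ x0 xy yq.
  have -> : U y - U x = - (segint w y q - segint w x q) by rewrite /U; ring.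
  by rewrite normrN.
have wU : primitive_on 0 q w U.
  move=> x y x0 xy yq; rewrite /U.
  rewrite (segint_cat xy yq (ess_bounded_subitv x0 (lexx q) wB)).
  by ring.
have uE' x : 0 <= x <= q -> u x = alpha + beta * x - dblint q w x.
  move=> xq; have [_ xq'] := andP xq; rewrite uE//.
  rewrite -[g_fun f q x]/(- dblint q f x).
  rewrite -[B_op a q u x]/(dblint q (fun t => a t * u t) x).
  by rewrite (dblintB fN auB xq') opprB addrA addrAC.
have Uu : primitive_on 0 q U u.
  move=> x y x0 xy yq.
  have VB := ess_bounded_subitv x0 yq (segint_tail_ess_bounded wB).
  have cB : ess_bounded_itv x y `|beta| (fun=> beta) by exact: ess_bounded_cst.
  rewrite (segintB cB VB) segint_cst// -(dblint_primitive wB x0 xy yq).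
  rewrite (uE' y) ?yq ?(le_trans x0 xy)// (uE' x) ?x0 ?(le_trans xy yq)//.
  by ring.
have <- : U q = beta.
  by rewrite /U (segint_xx (ess_bounded_subitv (ltW q0) (lexx q) wB)) subr0.
apply: (primitive_bvp_solution q0 wB UN M0 wU Uu).
by rewrite uE' ?lexx ?(ltW q0)// (dblint0 (ltW q0) wB) mulr0 addr0 subr0.
Qed.

End bvp.

Theorem theorem3p1 (R : realType) (x1 : R) (a f : R -> R) (alpha beta : R)
  (hx1 : 0 < x1)
  (ha : S_space x1 a) (hf : S_space x1 f)
  (hsmall : (S_norm x1 a * (x1 ^+ 2)%:E < 2%:E)%E)
  (hI2 : I2 a x1 x1 != 0) :
  exists u : R -> R,
    bvp_solution a f x1 alpha beta u /\
    forall x, x \in `[0, x1] ->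
      u x = beta * I1 a x1 x + alpha * I2 a x1 x + F_fun a f x1 x.
Proof.
have [A aE aA] := S_space_ess_bounded (ltW hx1) ha.
have [N _ fN] := S_space_ess_bounded (ltW hx1) hf.
rewrite aE -EFinM lte_fin in hsmall.
have idB : bounded_measurable x1 x1 id.
  split; [exact: ltW|exact: measurable_fun_cara|].
  by move=> x /andP[x0 xx1]; rewrite ger0_norm.
have oneB : bounded_measurable x1 1 (fun=> 1).
  by split=> // x _; rewrite normr1.
have gB : bounded_measurable x1 (N * (x1 ^+ 2 / 2)) (g_fun f x1).
  split.
  - by rewrite mulr_ge0 ?(ess_bounded_ge0 fN)// divr_ge0 ?sqr_ge0.
  - by apply: measurable_funN; exact: dblint_measurable fN.
  - by move=> x xx1; rewrite normrN; exact: dblint_le fN xx1.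
pose u x := beta * I1 a x1 x + alpha * I2 a x1 x + F_fun a f x1 x.
pose S x := beta * neumann x1 a id x + alpha * neumann x1 a (fun=> 1) x
  + neumann x1 a (g_fun f x1) x.
have uS x : 0 <= x <= x1 -> u x = S x.
  (* Only [I1] and [I2] remain to be treated: [F_fun] sums from index [0] and is convertible to the
     Neumann series of [g_fun]. *)
  move=> xx1; rewrite /u /S; congr (_ * _ + _ * _ + _).
  - exact: (neumann_from1 aA hsmall idB xx1 (a_seqS a x1)).
  - exact: (neumann_from1 aA hsmall oneB xx1 (b_seqS a x1)).
have S1 := neumann_bounded_measurable aA hsmall idB.
have S2 := neumann_bounded_measurable aA hsmall oneB.
have S3 := neumann_bounded_measurable aA hsmall gB.
have Z1 := bounded_measurableZ beta S1.
have Z2 := bounded_measurableZ alpha S2.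
have uB := bounded_measurableD (bounded_measurableD Z1 Z2) S3.
exists u; split=> //.
have {}uB := eq_bounded_measurable uS uB.
apply: (integral_equation_bvp_solution hx1 aA fN uB) => x xx1.
rewrite uS// (eq_B_op a uS xx1).
rewrite (B_opD aA (bounded_measurableD Z1 Z2) S3 xx1) (B_opD aA Z1 Z2 xx1).
rewrite (B_opZ aA beta S1 xx1) (B_opZ aA alpha S2 xx1).
(* Each series equals its source plus its image under [B]; the sources [x], [1] and [g] assemble to
   [alpha + beta x + g]. *)
rewrite /S (neumannE aA hsmall idB xx1) (neumannE aA hsmall oneB xx1).
rewrite (neumannE aA hsmall gB xx1) /=.
move: (B_op _ _ (neumann _ _ id) _) (B_op _ _ (neumann _ _ (fun=> 1)) _).
move: (B_op _ _ (neumann _ _ (g_fun _ _)) _) (g_fun _ _ _) => B3 g B1 B2.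
ring.
Qed.
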